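(* Let $G$ be a group of order equal to the product of at most two primes, where the two primes in question can be equal. Then $G$ is freely representable if and only if it is cyclic.
   Context: A free linear representation of a group $G$ over a field $F$ is a linear action of $G$ on an $F$-vector space $V \neq 0$ such that $gv \neq v$ for all $g \neq 1$ in $G$ and all nonzero $v \in V$. A finite group is freely representable if it has a free linear representation over $\mathbb{C}$. *)

(* Defs.v *)
From HB Require Import structures.
From mathcomp Require Import all_boot all_order all_algebra all_fingroup.
From mathcomp Require Import all_solvable complex reals.
Set Implicit Arguments.
Unset Strict Implicit.
Unset Printing Implicit Defensive.
Import GRing.Theory.
Local Open Scope ring_scope.

(* rho is only constrained on G; V may be infinite-dimensional. *)
Definition is_linear_action (F : fieldType) (gT : finGroupType)
    (G : {group gT}) (V : lmodType F) (rho : gT -> {linear V -> V}) : Prop :=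
  (forall v : V, rho 1%g v = v) /\
  (forall g h : gT, g \in G -> h \in G ->
     forall v : V, rho (g * h)%g v = rho g (rho h v)).

Definition is_free_linear_rep (F : fieldType) (gT : finGroupType)
    (G : {group gT}) (V : lmodType F) (rho : gT -> {linear V -> V}) : Prop :=
  [/\ is_linear_action G rho,
      exists v : V, v != 0 &
      forall g : gT, g \in G -> g != 1%g ->
        forall v : V, v != 0 -> rho g v != v].

(* C is R[i]. *)
Definition freely_representable (R : realType) (gT : finGroupType)
    (G : {group gT}) : Prop :=
  exists (V : lmodType R[i]) (rho : gT -> {linear V -> V}),
    is_free_linear_rep G rho.

(* The empty product is allowed, so n = 1 qualifies. *)
Definition product_of_at_most_two_primes (n : nat) : Prop :=
  exists s : seq nat,
    [/\ (size s <= 2)%N, all prime s & n = (\prod_(p <- s) p)%N].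

(* Main.v *)
(* In a free representation the vector sum_(h in H) h v is fixed by the
   subgroup H, hence vanishes when H is nontrivial.  If G is not cyclic, its
   nontrivial elements have prime order, so G \ {1} is the disjoint union of
   the sets C \ {1}, where C ranges over the m subgroups generated by one
   nontrivial element.  Summing over G and over each C gives 0 = v - m v, so
   m = 1 and G itself is the only such C.  Conversely a cyclic group of order n
   acts freely on the line through a primitive n-th root of unity. *)
Require Import Defs.
From HB Require Import structures.
From mathcomp Require Import all_boot all_order all_algebra all_fingroup.
From mathcomp Require Import all_solvable complex reals.
From mathcomp Require Import separable cyclotomic.
Import GRing.Theory Num.Theory.
Local Open Scope ring_scope.

Lemma prime_dvd_product_of_two_primes {n d : nat} :
  product_of_at_most_two_primes n ->
  (d %| n)%N -> d != 1%N -> d != n -> prime d.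
Proof.
case=> s [hs ps ->] dn d1 dNn.
have div_prime r e : prime r -> (e %| r)%N -> e != 1%N -> e = r.
  by case/primeP=> _ h /h /orP[->|/eqP].
case: s hs ps dn dNn => [|p [|q [|//]]] _ /=.
- by rewrite big_nil dvdn1 (negPf d1).
- by rewrite andbT big_seq1 => pp dp; rewrite (div_prime p d pp dp d1) eqxx.
rewrite andbT big_cons big_seq1 => /andP[pp pq] dpq dNpq.
(* If [p] divides [d], the cofactor divides [q] and cannot equal [q], so [d = p]; otherwise [d] is
   coprime to [p], hence divides [q] and equals it. *)
have [pd|] := boolP (p %| d)%N.
  case/dvdnP: pd dpq dNpq => e ->; rewrite [(e * p)%N]mulnC.
  rewrite dvdn_pmul2l ?prime_gt0 // => eq h.
  have [->|e1] := eqVneq e 1%N; first by rewrite muln1.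
  by rewrite (div_prime q e pq eq e1) eqxx in h.
rewrite -prime_coprime // coprime_sym => cdp.
by rewrite Gauss_dvdr // in dpq; rewrite (div_prime q d pq dpq d1).
Qed.

Lemma free_linear_rep_sum_eq0 {F : fieldType} {gT : finGroupType}
    {G H : {group gT}} {V : lmodType F} {rho : gT -> {linear V -> V}} (v : V) :
  is_free_linear_rep G rho -> H \subset G -> H :!=: 1%g ->
  \sum_(h in H) rho h v = 0.
Proof.
move=> [[_ rhoM] _ free] /subsetP sHG /trivgPn [g gH g1].
apply/eqP; apply: contraT => /(free g (sHG g gH) g1) /eqP[].
rewrite linear_sum [RHS](reindex_inj (mulgI g)) /=.
apply: eq_big => [h|h hH]; first by rewrite groupMl.
by rewrite rhoM ?sHG.
Qed.

(** The order of a nontrivial [y] in [<[x]>] divides a prime, so it equals [#[x]]. This identifies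
    each fibre of the map from an element to its cyclic subgroup [C] with [C] minus 1. *)
Lemma cycle_prime_generator {gT : finGroupType} {x y : gT} :
  prime #[x]%g -> (<[y]>%g == <[x]>%g) = (y != 1%g) && (y \in <[x]>%g).
Proof.
move=> px; apply/idP/andP => [/eqP e|[y1 yx]].
  rewrite -e cycle_id -order_gt1 /order e; split=> //.
  exact: prime_gt1.
rewrite eqEcard cycle_subG yx -!orderE /=.
have := order_dvdG yx; case/primeP: px => _ h /h.
by rewrite order_eq1 (negPf y1) => /= /eqP ->.
Qed.

Lemma free_linear_rep_cyclic {F : numFieldType} {gT : finGroupType}
    {G : {group gT}} {V : lmodType F} {rho : gT -> {linear V -> V}} :
  is_free_linear_rep G rho ->
  (forall x, x \in G -> x != 1%g -> prime #[x]%g) -> cyclic G.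
Proof.
move=> frho prG; have [[rho1 _] [v v0] _] := frho.
have [->|ntG] := eqVneq (G : {set gT}) 1%g; first exact: cyclic1.
pose P := [set <[x]>%g | x in G^#%g].
have cycle_sum C : C \in P ->
    \sum_(x in G^#%g | <[x]>%g == C) rho x v = - v.
  case/imsetP=> y /setD1P[y1 yG] ->.
  have := free_linear_rep_sum_eq0 v (H := <[y]>%G) frho.
  rewrite cycle_subG cycle_eq1 => /(_ yG y1).
  rewrite (bigD1 1%g) ?group1 //= rho1 => /eqP.
  rewrite addrC addr_eq0 => /eqP <-; apply: eq_bigl => x.
  rewrite cycle_prime_generator ?prG // in_setD1.
  have [->|_] /= := eqVneq x 1%g; first by rewrite andbF.
  rewrite andbT; have [xy|] := boolP (x \in <[y]>%g); last by rewrite andbF.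
  by rewrite (subsetP _ _ xy) ?cycle_subG.
have := free_linear_rep_sum_eq0 v frho (subxx G) ntG.
rewrite (bigD1 1%g) ?group1 //= rho1.
rewrite (eq_bigl (mem G^#%g)); last by move=> x; rewrite /= in_setD1 andbC.
rewrite (partition_big (fun x => <[x]>%g) (mem P)); last first.
  by move=> x xG; apply: imset_f.
(* Each fibre contributes [- v], so [v] equals [#|P|] times [v]; as [v] is nonzero and the
   characteristic is 0, [#|P|] is 1. *)
rewrite (eq_bigr (fun=> - v)) //= sumr_const mulNrn => /eqP.
rewrite subr_eq0 -[X in X == _]scale1r -scaler_nat -subr_eq0 -scalerBl.
rewrite scaler_eq0 (negPf v0) orbF subr_eq0 eq_sym pnatr_eq1 => /cards1P[C PC].
have [y yG y1] := trivgPn _ ntG.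
have mem_cycle_C x : x \in G -> x != 1%g -> <[x]>%g = C.
  by move=> xG x1; apply/set1P; rewrite -PC imset_f // in_setD1 x1.
apply: cyclicS (cycle_cyclic y); apply/subsetP=> x xG.
have [->|x1] := eqVneq x 1%g; first exact: group1.
by rewrite /= (mem_cycle_C y) // -(mem_cycle_C x) // cycle_id.
Qed.

(** Since [n] is invertible in [F], [X^n - 1] is separable and has [n] distinct roots; [n] distinct
    [n]-th roots of unity include a primitive one. *)
Lemma closed_field_prim_root {F : closedFieldType} {n : nat} :
  n%:R != 0 :> F -> exists z : F, n.-primitive_root z.
Proof.
move=> n0; have n_gt0 : (0 < n)%N by case: n n0 => //; rewrite eqxx.
have [r] := closed_field_poly_normal ('X^n - 1 : {poly F}).
rewrite (monicP (monicXnsubC 1 n_gt0)) scale1r => Dr.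
have: has n.-primitive_root r.
  apply: has_prim_root => //.
  - by apply/allP=> z; rewrite -root_prod_XsubC -Dr.
  - by rewrite -separable_prod_XsubC -Dr separable_Xn_sub_1.
  - by rewrite -ltnS -(size_prod_XsubC r id) -Dr size_XnsubC.
by case/hasP=> z _ hz; exists z.
Qed.

Lemma cycle_free_linear_rep {F : fieldType} {gT : finGroupType} {x : gT}
    {z : F} :
  #[x]%g.-primitive_root z ->
  exists rho : gT -> {linear F^o -> F^o}, is_free_linear_rep <[x]> rho.
Proof.
(* [k g] is the discrete logarithm of [g] to base [x], with default 0 outside [<[x]>]. *)
move=> hz; pose k (g : gT) := oapp val 0%N [pick i : 'I_#[x]%g | x ^+ i == g]%g.
have kP g : g \in <[x]>%g -> (x ^+ k g = g)%g.
  case/cyclePmin=> i ix ->; rewrite /k; case: pickP => [j /eqP //|] /=.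
  by move/(_ (Ordinal ix)); rewrite eqxx.
pose rho (g : gT) : {linear F^o -> F^o} := *:%R (z ^+ k g).
exists rho; split.
- split=> [v|g h gx hx v]; rewrite /rho /= ?scalerA -?exprD.
    suff -> : z ^+ k 1%g = 1 by rewrite scale1r.
    by apply/eqP; rewrite -(prim_order_dvd hz) order_dvdn kP.
  (* [k] is additive only modulo [#[x]], which is exactly the order of [z]. *)
  congr (_ *: _); apply/eqP; rewrite (eq_prim_root_expr hz).
  by rewrite -eq_expg_mod_order expgD !kP ?groupM.
- by exists 1; apply: oner_neq0.
move=> g gx g1 v v0; apply: contra g1; rewrite /rho /=.
rewrite -[X in _ == X]scale1r -subr_eq0 -scalerBl scaler_eq0 (negPf v0) orbF.
by rewrite subr_eq0 -(prim_order_dvd hz) order_dvdn kP.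
Qed.

Theorem theorem18 (R : realType) (gT : finGroupType) (G : {group gT})
    (hG : product_of_at_most_two_primes #|G|) :
  freely_representable R G <-> cyclic G.
Proof.
split=> [[V [rho frho]]|/cyclicP[x Gx]].
  (* The goal [false] is turned back into [cyclic G] while [ncG] stays available: it excludes
     elements of order [#|G|], so every nontrivial order is prime. *)
  apply: contraT => ncG; rewrite -(negbTE ncG).
  apply: free_linear_rep_cyclic frho _ => x xG x1.
  apply: prime_dvd_product_of_two_primes hG (order_dvdG xG) _ _.
    by rewrite order_eq1.
  apply: contra ncG => /eqP ox; apply/cyclicP; exists x; apply/esym/eqP.
  by rewrite eqEcard cycle_subG xG -ox leqnn.
have [|z hz] := @closed_field_prim_root R[i] #[x]%g.
  by rewrite pnatr_eq0 -lt0n order_gt0.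
have [rho frho] := cycle_free_linear_rep hz.
exists R[i]^o, rho; suff -> : G = <[x]>%G by [].
exact: val_inj.
Qed.
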